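(* Let $X\subset\mathbb{R}^n$ be a convex closed set and let $r>0$. Assume that $f\in\mathbb{R}[x]$, $x=(x_1,\dots,x_n)$, is a polynomial of degree $d>0$ such that there exists $m\in\mathbb{R}$ with $0<m<\inf\{f(x):x\in X\}$. Then there exists $N_0\in\mathbb{N}$ such that for any integer $N\ge N_0$ and any $\xi\in\mathbb{R}^n$ with $|\xi|\le r$, the function $\varPhi_{N,\xi}(x)=e^{e^{N|x-\xi|^2}}f(x)$ is strongly convex on $X$. Moreover, there exists $\alpha\in\mathbb{R}$ such that the function $\varPhi_\xi(x)=e^{e^{|x-\xi|^2}}[f(x)+\alpha]$, $x\in\mathbb{R}^n$, is strongly convex on $X$ for every $\xi\in\mathbb{R}^n$ with $|\xi|\le r$.
   Context: $|\cdot|$ is the Euclidean norm on $\mathbb{R}^n$. A function $\varphi$ is strongly convex on a convex set $X$ if for some $\mu>0$ the function $\varphi(x)-\frac{\mu}{2}|x|^2$ is convex on $X$. *)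

(* Defs.v *)
From mathcomp Require Import all_boot all_order all_algebra.
From mathcomp Require Import all_classical all_reals all_analysis.
(* The notations of mpoly clash with those of MathComp-Analysis. *)
From mathcomp Require Import -(notations) mpoly.
Set Implicit Arguments.
Unset Strict Implicit.
Unset Printing Implicit Defensive.
Import Order.TTheory GRing.Theory Num.Theory numFieldNormedType.Exports.
Local Open Scope ring_scope.

(* The norm `|x| that MathComp puts on 'rV[R]_n is the sup norm. *)
Definition enorm (R : realType) (n : nat) (x : 'rV[R]_n) : R :=
  Num.sqrt (\sum_(i < n) x 0 i ^+ 2).

Definition peval (R : realType) (n : nat) (f : mpoly n R) (x : 'rV[R]_n) : R :=
  meval (fun i => x 0 i) f.

Definition strongly_convex (R : realType) (n : nat) (X : set 'rV[R]_n)
    (phi : 'rV[R]_n -> R) : Prop :=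
  exists mu : R, 0 < mu /\
    convex_function X (fun x : 'rV[R]_n => phi x - mu / 2 * enorm x ^+ 2).

(* Main.v *)
Require Import Defs.
From mathcomp Require Import all_boot all_order all_algebra.
From mathcomp Require Import all_classical all_reals all_analysis.
From mathcomp Require Import -(notations) mpoly.
From mathcomp Require Import ring lra.
Import Order.TTheory GRing.Theory Num.Theory numFieldNormedType.Exports.
Local Open Scope classical_set_scope.
Local Open Scope ring_scope.

(** Convexity is a statement about lines. Along [x = a + t v], with
    [s = c |x - xi|^2], [E = exp s], [u = <x - xi, v>] and [g], [g1], [g2] the
    values of [f] and of its first two derivatives in direction [v], the second
    derivative of [exp (exp s) f] is [exp E] times
    [[
      (E^2 + E) (2 c u)^2 g  +  2 c |v|^2 E g  +  2 E (2 c u) g1  +  g2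
    ]]
    The only indefinite terms are the last two. The mixed term is absorbed by
    completing a square against [E^2 (2 c u)^2 m], where [m] is a positive lower
    bound of [f] on [X], at the cost of [g1^2 / m]. This cost and [g2] have to be
    outweighed by [2 c |v|^2 E g], and here the inner exponential is essential:
    for [exp s f] the bracket would carry no factors [E], and [2 c |v|^2 g] need
    not control the growth of the derivatives of [f].

    A polynomial grows more slowly than [exp (|x - xi|^2)], so there is a
    constant [K], common to all [|xi| <= r], with [g1^2] and [|g2|] at most
    [K |v|^2 exp (|x - xi|^2)] ([dirderiv_le_gauss]), hence at most
    [K |v|^2 E] as soon as [1 <= c]. The bracket is then at least
    [(2 c m - K / m - K) |v|^2 E] ([double_exp_second_derivative_ge]), and since
    [E] and [exp E] are at least [1], strong convexity follows whenever
    [1 <= 2 c m - K / m - K] ([strongly_convex_double_exp]).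

    This condition can be met in two ways. With [f] fixed, take [c = N] large.
    With [c = 1], add a constant to [f]: the derivatives, and so [K], do not
    change, while [m] becomes as large as needed. *)

(** * Induction on polynomials *)

(** Polynomials are generated as a ring by constants and variables, so a
    property stable under sums and products need not be checked monomial by
    monomial. *)
Lemma mpoly_subring_ind {R : comNzRingType} {n : nat} (P : mpoly n R -> Prop) :
  (forall c, P (mpolyC n c)) ->
  (forall i, P (mpolyX R (mnm1 i))) ->
  (forall p q, P p -> P q -> P (p + q)) ->
  (forall p q, P p -> P q -> P (p * q)) ->
  forall p, P p.
Proof.
move=> PC PX PD PM.
have Pexp p k : P p -> P (p ^+ k).
  move=> Pp; elim: k => [|k IH]; last by rewrite exprS; apply: PM.
  by rewrite expr0 -mpolyC1; apply: PC.
elim/mpolyind => [|c m p _ _ Pp]; first by rewrite -mpolyC0; apply: PC.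
apply: PD => //; rewrite -mul_mpolyC; apply: (PM); first exact: PC.
rewrite (mpolyXE_id _ m); apply: (big_ind P).
- by rewrite -mpolyC1; apply: PC.
- exact: PM.
- by move=> i _; apply: Pexp.
Qed.

(** * The Euclidean norm *)
Definition dot {R : realType} {n} (x y : 'rV[R]_n) : R := \sum_(i < n) x 0 i * y 0 i.

Lemma enorm2E {R : realType} {n} (x : 'rV[R]_n) : enorm x ^+ 2 = \sum_(i < n) x 0 i ^+ 2.
Proof. by rewrite sqr_sqrtr // sumr_ge0 // => i _; apply: sqr_ge0. Qed.

Lemma sqr_coord_le_enorm2 {R : realType} {n} (x : 'rV[R]_n) i : x 0 i ^+ 2 <= enorm x ^+ 2.
Proof.
rewrite enorm2E (bigD1 i) //= lerDl.
by apply: sumr_ge0 => j _; apply: sqr_ge0.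
Qed.

Lemma normM_coord_le_enorm2 {R : realType} {n} (x : 'rV[R]_n) i j :
  `|x 0 i * x 0 j| <= enorm x ^+ 2.
Proof.
have Hi := sqr_coord_le_enorm2 x i; have Hj := sqr_coord_le_enorm2 x j.
rewrite ler_norml; nra.
Qed.

Lemma enorm2_le_shift {R : realType} {n} (x y : 'rV[R]_n) :
  enorm x ^+ 2 <= 2 * enorm (x - y) ^+ 2 + 2 * enorm y ^+ 2.
Proof.
rewrite !enorm2E !mulr_sumr -big_split /=; apply: ler_sum => i _.
rewrite !mxE; have := sqr_ge0 (x 0 i - 2 * y 0 i); nra.
Qed.

Lemma enorm2_line {R : realType} {n} (a v : 'rV[R]_n) (t : R) :
  enorm (a + t *: v) ^+ 2 = enorm a ^+ 2 + t * (2 * dot a v + t * enorm v ^+ 2).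
Proof.
rewrite !enorm2E /dot !mulr_sumr -big_split /= mulr_sumr -big_split /=.
apply: eq_bigr => i _.
by rewrite !mxE; ring.
Qed.

Lemma dot_line {R : realType} {n} (a v : 'rV[R]_n) (t : R) :
  dot (a + t *: v) v = dot a v + t * enorm v ^+ 2.
Proof.
rewrite !enorm2E /dot !mulr_sumr -!big_split /=; apply: eq_bigr => i _.
by rewrite !mxE; ring.
Qed.

(** * Gaussian bounds for polynomials and their derivatives *)

(** Apply [1 + y <= exp y] to [y = s / (k + 1)] and raise to the power [k]. *)
Lemma powD1_le_expR {R : realType} k (s : R) : 0 <= s ->
  (1 + s) ^+ k <= k.+1%:R ^+ k * expR s.
Proof.
move=> s0; have k0 : 0 < k.+1%:R :> R by rewrite ltr0n.
have Hs : 1 + s <= k.+1%:R * expR (s / k.+1%:R).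
  apply: (@le_trans _ _ (k.+1%:R * (1 + s / k.+1%:R))); last first.
    by rewrite ler_pM2l // expR_ge1Dx.
  by rewrite mulrDr mulr1 mulrC divfK ?gt_eqF // lerD2r ler1n.
apply: (@le_trans _ _ ((k.+1%:R * expR (s / k.+1%:R)) ^+ k)).
  by rewrite lerXn2r // nnegrE ?addr_ge0 // mulr_ge0 ?expR_ge0 // ltW.
rewrite exprMn ler_wpM2l ?exprn_ge0 ?ler0n // -expRM_natl ler_expR.
by rewrite mulrA ler_pdivrMr // mulrC ler_wpM2l // ler_nat leqnSn.
Qed.

(** The bounding functions are powers of [1 + |x|^2] because these are at least
    [1] and closed under products up to constants, which is what the induction
    on [p] needs; the Gaussian bound below is not stable under products. *)
Lemma peval_growth {R : realType} {n} (p : mpoly n R) :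
  exists C k, 0 <= C /\ forall x : 'rV[R]_n, `|peval p x| <= C * (1 + enorm x ^+ 2) ^+ k.
Proof.
have ge1 (x : 'rV[R]_n) : 1 <= 1 + enorm x ^+ 2 by rewrite lerDl sqr_ge0.
elim/(@mpoly_subring_ind R n): p => [c|i|p q|p q].
- exists `|c|, 0%N; split=> // x.
  by rewrite /peval mevalC expr0 mulr1.
- exists 1, 1%N; split=> // x; rewrite /peval mevalXU expr1 mul1r.
  have := sqr_coord_le_enorm2 x i; rewrite ler_norml; nra.
- move=> [C [k [C0 Hp]]] [D [l [D0 Hq]]]; exists (C + D), (k + l)%N.
  split=> [|x]; first exact: addr_ge0.
  rewrite /peval mevalD (le_trans (ler_normD _ _)) // mulrDl lerD //.
    by rewrite (le_trans (Hp x)) // ler_wpM2l // ler_weXn2l // leq_addr.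
  by rewrite (le_trans (Hq x)) // ler_wpM2l // ler_weXn2l // leq_addl.
- move=> [C [k [C0 Hp]]] [D [l [D0 Hq]]]; exists (C * D), (k + l)%N.
  split=> [|x]; first exact: mulr_ge0.
  by rewrite /peval mevalM normrM exprD mulrACA; apply: ler_pM; rewrite ?normr_ge0 ?Hp ?Hq.
Qed.

(** The centre [xi] ranges over a bounded set, so [1 + |x|^2] is at most a fixed
    multiple of [1 + |x - xi|^2], and [C] can be chosen independently of [xi]. *)
Lemma peval_le_gauss {R : realType} {n} r (p : mpoly n R) :
  exists2 C, 0 <= C & forall x xi : 'rV[R]_n, enorm xi <= r ->
    `|peval p x| <= C * expR (enorm (x - xi) ^+ 2).
Proof.
have [C [k [C0 Hp]]] := peval_growth p.
exists (C * ((2 + 2 * r ^+ 2) ^+ k * k.+1%:R ^+ k)).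
  by rewrite mulr_ge0 // mulr_ge0 // exprn_ge0 // addr_ge0 // mulr_ge0 // sqr_ge0.
move=> x xi xir; apply: (le_trans (Hp x)).
rewrite -!mulrA ler_wpM2l //.
have s0 := sqr_ge0 (enorm (x - xi)).
have r2 : enorm xi ^+ 2 <= r ^+ 2.
  by rewrite lerXn2r // nnegrE ?sqrtr_ge0 // (le_trans (sqrtr_ge0 _) xir).
have r20 := sqr_ge0 r.
apply: (@le_trans _ _ (((2 + 2 * r ^+ 2) * (1 + enorm (x - xi) ^+ 2)) ^+ k)).
  rewrite lerXn2r // ?nnegrE; have := enorm2_le_shift x xi; have := sqr_ge0 (enorm x); nra.
rewrite exprMn ler_wpM2l ?powD1_le_expR // exprn_ge0 //; nra.
Qed.

(** Both the square of a first directional derivative and a second directional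
    derivative are quadratic forms in the direction with polynomial
    coefficients; this bounds the two at once. *)
Lemma quad_form_le_gauss {R : realType} {n} r (q : 'I_n -> 'I_n -> mpoly n R) :
  exists2 C, 0 <= C & forall x v xi : 'rV[R]_n, enorm xi <= r ->
    `|\sum_i \sum_j v 0 i * v 0 j * peval (q i j) x|
      <= C * enorm v ^+ 2 * expR (enorm (x - xi) ^+ 2).
Proof.
have /choice [C HC] : forall ij : 'I_n * 'I_n, exists C : R, 0 <= C /\
    forall x xi : 'rV[R]_n, enorm xi <= r ->
      `|peval (q ij.1 ij.2) x| <= C * expR (enorm (x - xi) ^+ 2).
  by move=> [i j]; have [C] := peval_le_gauss r (q i j); exists C.
exists (\sum_i \sum_j C (i, j)).
  by do 2!apply: sumr_ge0 => ? _; apply: (HC _).1.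
move=> x v xi xir; rewrite !mulr_suml (le_trans (ler_norm_sum _ _ _)) //.
apply: ler_sum => i _; rewrite !mulr_suml (le_trans (ler_norm_sum _ _ _)) //.
apply: ler_sum => j _; rewrite normrM [C _ * _]mulrC -mulrA.
by rewrite ler_pM ?normM_coord_le_enorm2 //; apply: (HC (i, j)).2.
Qed.

Definition dirderiv {R : realType} {n} (v : 'rV[R]_n) (p : mpoly n R) : mpoly n R :=
  \sum_i v 0 i *: mderiv i p.

Lemma peval_dirderiv {R : realType} {n} (v x : 'rV[R]_n) (p : mpoly n R) :
  peval (dirderiv v p) x = \sum_i v 0 i * peval (mderiv i p) x.
Proof.
rewrite /peval /dirderiv raddf_sum /=; apply: eq_bigr => i _; exact: mevalZ.
Qed.

Lemma peval_dirderiv2 {R : realType} {n} (v x : 'rV[R]_n) (p : mpoly n R) :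
  peval (dirderiv v (dirderiv v p)) x =
    \sum_i \sum_j v 0 i * v 0 j * peval (mderiv i (mderiv j p)) x.
Proof.
rewrite peval_dirderiv; apply: eq_bigr => i _.
rewrite /dirderiv /peval (raddf_sum (mderiv i)) (raddf_sum (meval _)) mulr_sumr.
apply: eq_bigr => j _.
by rewrite /= mderivZ mevalZ mulrA.
Qed.

Lemma sqr_peval_dirderiv {R : realType} {n} (v x : 'rV[R]_n) (p : mpoly n R) :
  peval (dirderiv v p) x ^+ 2 =
    \sum_i \sum_j v 0 i * v 0 j * peval (mderiv i p * mderiv j p) x.
Proof.
rewrite peval_dirderiv expr2 mulr_suml; apply: eq_bigr => i _.
rewrite mulr_sumr; apply: eq_bigr => j _.
by rewrite /peval mevalM mulrACA.
Qed.

(** The formal derivative computes the analytic one: both obey the sum and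
    Leibniz rules, so they agree once they agree on the generators. *)
Lemma is_derive_peval_line {R : realType} {n} (a v : 'rV[R]_n) (p : mpoly n R) (t : R) :
  is_derive t 1 (fun s : R => peval p (a + s *: v)) (peval (dirderiv v p) (a + t *: v)).
Proof.
rewrite peval_dirderiv; elim/(@mpoly_subring_ind R n): p => [c|i|p q dp dq|p q dp dq].
- under eq_fun do rewrite /peval mevalC.
  rewrite big1 => [|i _]; first exact: (is_derive_cst c t 1).
  by rewrite mderivC /peval meval0 mulr0.
- under eq_fun do rewrite /peval mevalXU !mxE.
  rewrite (bigD1 i) //= big1 => [|j ji]; last first.
    by rewrite mderivX mnm1E eq_sym (negPf ji) scale0r /peval meval0 mulr0.
  have mnm_subnn : mnm_sub (mnm1 i) (mnm1 i) = mnm0.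
    by apply/mnmP => j; rewrite mnmBE mnm0E subnn.
  rewrite mderivX mnm1E eqxx scale1r /peval mnm_subnn mpolyX0 meval1.
  apply: (is_derive_eq (is_deriveD (is_derive_cst (a 0 i) t 1)
    (is_deriveM (is_derive_id t 1) (is_derive_cst (v 0 i) t 1)))).
  by rewrite /= /cst /= scaler0 /GRing.scale /=; ring.
- under eq_fun do rewrite /peval mevalD.
  apply: (is_derive_eq (is_deriveD dp dq)).
  rewrite -big_split /=; apply: eq_bigr => i _.
  by rewrite mderivD /peval mevalD mulrDr.
- under eq_fun do rewrite /peval mevalM.
  apply: (is_derive_eq (is_deriveM dp dq)).
  rewrite /GRing.scale /= !mulr_sumr -big_split /=; apply: eq_bigr => i _.
  by rewrite mderivM /peval mevalD !mevalM /peval; ring.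
Qed.

(** The constant is uniform in the centre, the direction and the point, which is
    what lets one [N0] or one [alpha] serve every [xi]. *)
Lemma dirderiv_le_gauss {R : realType} {n} (r : R) (p : mpoly n R) :
  exists2 K, 0 <= K & forall xi : 'rV[R]_n, enorm xi <= r -> forall v x : 'rV[R]_n,
     peval (dirderiv v p) x ^+ 2 <= K * enorm v ^+ 2 * expR (enorm (x - xi) ^+ 2) /\
     `|peval (dirderiv v (dirderiv v p)) x|
       <= K * enorm v ^+ 2 * expR (enorm (x - xi) ^+ 2).
Proof.
have [A A0 HA] := quad_form_le_gauss r (fun i j => mderiv i p * mderiv j p).
have [B B0 HB] := quad_form_le_gauss r (fun i j => mderiv i (mderiv j p)).
exists (A + B) => [|xi xir v x]; first exact: addr_ge0.
have w0 := sqr_ge0 (enorm v).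
split.
  rewrite sqr_peval_dirderiv (le_trans (ler_norm _)) // (le_trans (HA x v xi xir)) //.
  by rewrite ler_wpM2r ?expR_ge0 // ler_wpM2r // lerDl.
rewrite peval_dirderiv2 (le_trans (HB x v xi xir)) //.
by rewrite ler_wpM2r ?expR_ge0 // ler_wpM2r // lerDr.
Qed.

Lemma dirderiv_addC {R : realType} {n} (v : 'rV[R]_n) (p : mpoly n R) (c : R) :
  dirderiv v (p + mpolyC n c) = dirderiv v p.
Proof. by apply: eq_bigr => i _; rewrite mderivD mderivC addr0. Qed.

(** * Convexity from second derivatives along lines *)

(** On the segment from [a] to [b] this is the one-variable criterion for
    [s |-> phi (a + s (b - a))] on [[0, 1]]; convexity of [X] keeps the segment
    inside [X], where the sign of the second derivative is known. *)
Lemma convex_function_along_lines {R : realType} {n} {X : set 'rV[R]_n}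
    {phi : 'rV[R]_n -> R} (D1 D2 : 'rV[R]_n -> 'rV[R]_n -> R) :
  convex_set X ->
  (forall (a v : 'rV[R]_n) (t : R),
     is_derive t 1 (fun s : R => phi (a + s *: v)) (D1 v (a + t *: v))) ->
  (forall (a v : 'rV[R]_n) (t : R),
     is_derive t 1 (fun s : R => D1 v (a + s *: v)) (D2 v (a + t *: v))) ->
  (forall v x, X x -> 0 <= D2 v x) ->
  convex_function X phi.
Proof.
(* With weight t on a, the point t a + (1 - t) b is reached at time 1 - t. *)
move=> Xconv d1 d2 D2ge0 t a b aX bX.
pose v : 'rV[R]_n := b - a; pose h (s : R) := phi (a + s *: v).
have dh (s : R) : is_derive s 1 h (D1 v (a + s *: v)) by exact: d1.
have Dh : 'D_1 h = fun s => D1 v (a + s *: v).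
  by apply/funext => s; apply: (derive_val (is_derive := dh s)).
have hcont (s : R) : h x @[x --> s] --> h s.
  by apply/differentiable_continuous/derivable1_diffP/(ex_derive (is_derive := dh s)).
have inX (s : R) : 0 < s < 1 -> X (a + s *: v).
  move=> /andP[/ltW s0 /ltW s1].
  have := Xconv b a (Itv01 s0 s1) bX aX; rewrite inE; congr X.
  rewrite /conv /= /v /unstable.onem; apply/rowP => i; rewrite !mxE; ring.
have hconv : h (conv t (0 : R^o) 1) <= conv t (h 0 : R^o) (h 1).
  apply: second_derivative_convex => //.
  - by move=> s s01; rewrite Dh (derive_val (is_derive := d2 a v s)); apply/D2ge0/inX.
  - by apply: cvg_at_left_filter; apply: hcont.
  - by apply: cvg_at_right_filter; apply: hcont.
  - by move=> s _; rewrite Dh; apply: (ex_derive (is_derive := d2 a v s)).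
have h01 : h (conv t (0 : R^o) 1) = phi (conv t (a : convex_lmodType 'rV[R]_n) b).
  rewrite /h convRE mulr0 add0r mulr1 /conv /=; congr phi; apply/rowP => i.
  by rewrite !mxE /unstable.onem; ring.
by move: hconv; rewrite h01 /h scale0r addr0 scale1r /v subrKC.
Qed.

Lemma is_derive_enorm2_line {R : realType} {n} (xi a v : 'rV[R]_n) (t : R) :
  is_derive t 1 (fun s : R => enorm (a + s *: v - xi) ^+ 2)
    (2 * dot (a + t *: v - xi) v).
Proof.
under eq_fun do rewrite addrAC enorm2_line.
rewrite addrAC dot_line.
apply: (is_derive_eq (is_deriveD (is_derive_cst (enorm (a - xi) ^+ 2) t 1)
  (is_deriveM (is_derive_id t 1)
    (is_deriveD (is_derive_cst (2 * dot (a - xi) v) t 1)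
      (is_deriveM (is_derive_id t 1) (is_derive_cst (enorm v ^+ 2) t 1)))))).
by rewrite !fctE /= /cst /= !scaler0 /GRing.scale /=; ring.
Qed.

Lemma is_derive_dot_line {R : realType} {n} (xi a v : 'rV[R]_n) (t : R) :
  is_derive t 1 (fun s : R => dot (a + s *: v - xi) v) (enorm v ^+ 2).
Proof.
under eq_fun do rewrite addrAC dot_line.
apply: (is_derive_eq (is_deriveD (is_derive_cst (dot (a - xi) v) t 1)
   (is_deriveM (is_derive_id t 1) (is_derive_cst (enorm v ^+ 2) t 1)))).
by rewrite /= /cst /= !scaler0 /GRing.scale /=; ring.
Qed.

Lemma strongly_convex_along_lines {R : realType} {n} {X : set 'rV[R]_n}
    {phi : 'rV[R]_n -> R} (D1 D2 : 'rV[R]_n -> 'rV[R]_n -> R) (mu : R) :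
  convex_set X -> 0 < mu ->
  (forall (a v : 'rV[R]_n) (t : R),
     is_derive t 1 (fun s : R => phi (a + s *: v)) (D1 v (a + t *: v))) ->
  (forall (a v : 'rV[R]_n) (t : R),
     is_derive t 1 (fun s : R => D1 v (a + s *: v)) (D2 v (a + t *: v))) ->
  (forall v x, X x -> mu * enorm v ^+ 2 <= D2 v x) ->
  strongly_convex X phi.
Proof.
move=> Xconv mu0 d1 d2 D2ge; exists mu; split=> //.
apply: (convex_function_along_lines
  (* |x|^2 is treated as |x - xi|^2 with xi = 0, whence the x - 0. *)
  (fun v x => D1 v x - mu * dot (x - 0) v) (fun v x => D2 v x - mu * enorm v ^+ 2)) => //.
- move=> a v t.
  under eq_fun do rewrite -[X in enorm X]subr0.
  apply: (is_derive_eq (is_deriveB (d1 a v t)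
    (is_deriveM (is_derive_cst (mu / 2) t 1) (is_derive_enorm2_line 0 a v t)))).
  by rewrite /= /cst /= scaler0 /GRing.scale /=; field.
- move=> a v t.
  apply: (is_derive_eq (is_deriveB (d2 a v t)
    (is_deriveM (is_derive_cst mu t 1) (is_derive_dot_line 0 a v t)))).
  by rewrite /= /cst /= scaler0 /GRing.scale /= addr0.
- by move=> v x xX; rewrite subr_ge0; apply: D2ge.
Qed.

(** * Strong convexity of the doubly exponential weight *)

(** The pointwise inequality behind the theorem: [c], [u], [w] stand for the
    rate, [<x - xi, v>] and [|v|^2], and [P], [E] for [exp (exp s)] and [exp s]. *)
Lemma double_exp_second_derivative_ge {R : realFieldType} {P E c u w m g g1 g2 K : R} :
  1 <= P -> 1 <= E -> 0 <= c -> 0 <= w -> 0 < m -> m <= g ->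
  g1 ^+ 2 <= K * w * E -> `|g2| <= K * w * E ->
  1 <= 2 * c * m - K / m - K ->
  w <= P * ((E ^+ 2 + E) * (2 * c * u) ^+ 2 * g + E * (2 * c * w) * g
            + 2 * E * (2 * c * u) * g1 + g2).
Proof.
move=> P1 E1 c0 w0 m0 mg g1K g2K large.
pose s := 2 * c * u.
have wE : w <= w * E by rewrite ler_peMr.
(* Minimising E^2 s^2 m + 2 E s g1 over s gives - g1^2 / m. *)
have square : - (K * w * E / m) <= (E ^+ 2 + E) * s ^+ 2 * g + 2 * E * s * g1.
  have H1 : E ^+ 2 * s ^+ 2 * m <= (E ^+ 2 + E) * s ^+ 2 * g.
    apply: ler_pM => //; [by rewrite mulr_ge0 ?sqr_ge0|exact: ltW|].
    by rewrite ler_wpM2r ?sqr_ge0 // lerDl (le_trans ler01).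
  have H2 : g1 ^+ 2 / m <= K * w * E / m by rewrite ler_pM2r ?invr_gt0.
  have H3 : (E * s * m + g1) ^+ 2 / m = E ^+ 2 * s ^+ 2 * m + 2 * E * s * g1 + g1 ^+ 2 / m.
    by field; rewrite gt_eqF.
  have H4 : 0 <= (E * s * m + g1) ^+ 2 / m by rewrite mulr_ge0 ?sqr_ge0 // invr_ge0 ltW.
  lra.
have curv : 2 * c * m * (w * E) <= E * (2 * c * w) * g.
  have -> : 2 * c * m * (w * E) = E * (2 * c * w) * m by ring.
  by rewrite ler_wpM2l // !mulr_ge0 // (le_trans ler01).
have g2lo : - (K * w * E) <= g2 by move: g2K; rewrite ler_norml => /andP[].
have main : w * E <= (2 * c * m - K / m - K) * (w * E).
  by rewrite ler_peMl // mulr_ge0 // (le_trans ler01).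
have KE : K / m * (w * E) = K * w * E / m by field; rewrite gt_eqF.
apply: (@le_trans _ _ ((E ^+ 2 + E) * s ^+ 2 * g + E * (2 * c * w) * g
            + 2 * E * s * g1 + g2)); first nra.
rewrite ler_peMl //; nra.
Qed.

Lemma is_derive_expR_comp {R : realType} {s : R -> R} {t ds : R} :
  is_derive t 1 s ds -> is_derive t 1 (fun x => expR (s x)) (expR (s t) * ds).
Proof. by move=> s'; apply: (is_derive1_comp (is_derive_expR (s t)) s'). Qed.

Lemma strongly_convex_double_exp {R : realType} {n} {X : set 'rV[R]_n}
    (p : mpoly n R) (m c K : R) (xi : 'rV[R]_n) :
  convex_set X -> 0 < m -> 1 <= c -> (forall x, X x -> m <= peval p x) ->
  (forall v x, peval (dirderiv v p) x ^+ 2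
     <= K * enorm v ^+ 2 * expR (enorm (x - xi) ^+ 2)) ->
  (forall v x, `|peval (dirderiv v (dirderiv v p)) x|
     <= K * enorm v ^+ 2 * expR (enorm (x - xi) ^+ 2)) ->
  0 <= K -> 1 <= 2 * c * m - K / m - K ->
  strongly_convex X (fun x => expR (expR (c * enorm (x - xi) ^+ 2)) * peval p x).
Proof.
move=> Xconv m0 c1 mp dp ddp K0 large.
have c0 : 0 <= c := le_trans ler01 c1.
pose E x := expR (c * enorm (x - xi) ^+ 2).
pose S1 v x := 2 * c * dot (x - xi) v.
pose G1 v x := peval (dirderiv v p) x.
pose G2 v x := peval (dirderiv v (dirderiv v p)) x.
pose D1 v x := expR (E x) * (E x * S1 v x * peval p x + G1 v x).
pose D2 v x := expR (E x) * ((E x ^+ 2 + E x) * S1 v x ^+ 2 * peval p x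
  + E x * (2 * c * enorm v ^+ 2) * peval p x + 2 * E x * S1 v x * G1 v x + G2 v x).
have dE (a v : 'rV[R]_n) (t : R) :
    is_derive t 1 (fun s : R => E (a + s *: v)) (E (a + t *: v) * S1 v (a + t *: v)).
  apply: is_derive_expR_comp.
  apply: (is_derive_eq (is_deriveM (is_derive_cst c t 1) (is_derive_enorm2_line xi a v t))).
  by rewrite /S1 /cst /= scaler0 /GRing.scale /=; ring.
have dS1 (a v : 'rV[R]_n) (t : R) :
    is_derive t 1 (fun s : R => S1 v (a + s *: v)) (2 * c * enorm v ^+ 2).
  apply: (is_derive_eq (is_deriveM (is_derive_cst (2 * c) t 1) (is_derive_dot_line xi a v t))).
  by rewrite /cst /= scaler0 /GRing.scale /=; ring.
have dG (a v : 'rV[R]_n) (t : R) := is_derive_peval_line a v p t.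
have dG1 (a v : 'rV[R]_n) (t : R) := is_derive_peval_line a v (dirderiv v p) t.
apply: (strongly_convex_along_lines D1 D2 1 Xconv ltr01).
- move=> a v t.
  apply: (is_derive_eq (is_deriveM (is_derive_expR_comp (dE a v t)) (dG a v t))).
  by rewrite /D1 /G1 /= /GRing.scale /=; ring.
- move=> a v t.
  apply: (is_derive_eq (is_deriveM (is_derive_expR_comp (dE a v t))
    (is_deriveD (is_deriveM (is_deriveM (dE a v t) (dS1 a v t)) (dG a v t)) (dG1 a v t)))).
  by rewrite !fctE /D2 /G1 /G2 /= /GRing.scale /=; ring.
- move=> v x xX; rewrite mul1r.
  have w0 := sqr_ge0 (enorm v); have y0 := sqr_ge0 (enorm (x - xi)).
  have E1 : 1 <= E x by rewrite -expR0 ler_expR mulr_ge0.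
  have P1 : 1 <= expR (E x) by rewrite -expR0 ler_expR (le_trans ler01).
  have gaussE : K * enorm v ^+ 2 * expR (enorm (x - xi) ^+ 2) <= K * enorm v ^+ 2 * E x.
    apply: ler_wpM2l; first by rewrite mulr_ge0.
    by rewrite ler_expR ler_peMl.
  apply: (double_exp_second_derivative_ge (m := m) (K := K)) => //; first exact: mp.
    exact: le_trans (dp v x) gaussE.
  exact: le_trans (ddp v x) gaussE.
Qed.

Theorem theorem7 (R : realType) (n : nat) (X : set 'rV[R]_n) (r : R)
    (d : nat) (f : mpoly n R)
    (Xconvex : convex_set X) (Xclosed : closed X) (r_gt0 : 0 < r)
    (d_gt0 : (0 < d)%N) (deg_f : mpoly.msize f = d.+1)
    (inf_f : exists m : R,
       0 < m /\ (m%:E < ereal_inf [set (peval f x)%:E | x in X])%E) :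
  (exists N0 : nat, forall N : nat, (N0 <= N)%N ->
     forall xi : 'rV[R]_n, enorm xi <= r ->
       strongly_convex X
         (fun x => expR (expR (N%:R * enorm (x - xi) ^+ 2)) * peval f x)) /\
  (exists alpha : R, forall xi : 'rV[R]_n, enorm xi <= r ->
     strongly_convex X
       (fun x => expR (expR (enorm (x - xi) ^+ 2)) * (peval f x + alpha))).
Proof.
have [m [m0 m_inf]] := inf_f.
have mf x : X x -> m <= peval f x.
  move=> xX; rewrite -lee_fin; apply: (le_trans (ltW m_inf)).
  by apply: ereal_inf_lbound; exists x.
have [K K0 HK] := dirderiv_le_gauss r f.
split.
- pose B := (1 + K / m + K) / (2 * m).
  have Km0 : 0 <= K / m by rewrite divr_ge0 // ltW.
  have B0 : 0 <= B by rewrite divr_ge0 ?mulr_ge0 ?addr_ge0 // ltW.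
  (* B is the value of c at which 2 c m - K / m - K = 1; the successor
     ensures 1 <= N. *)
  exists (Num.bound B).+1 => N NN0 xi xir.
  have N1 : 1 <= N%:R :> R by rewrite ler1n (leq_trans _ NN0).
  have BN : B <= N%:R.
    by rewrite (le_trans (ltW (archi_boundP B0))) // ler_nat ltnW.
  apply: (strongly_convex_double_exp f m _ K) => //.
  + by move=> v x; have [] := HK xi xir v x.
  + by move=> v x; have [] := HK xi xir v x.
  + move: BN; rewrite /B ler_pdivrMr ?mulr_gt0 //; lra.
- (* With M = m + (1 + K) one has 2 M >= 2 + 2 K, while K / M <= 1. *)
  exists (1 + K) => xi xir.
  have -> : (fun x => expR (expR (enorm (x - xi) ^+ 2)) * (peval f x + (1 + K)))
    = (fun x => expR (expR (1 * enorm (x - xi) ^+ 2)) * peval (f + mpolyC n (1 + K)) x).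
    by apply/funext => x; rewrite mul1r /peval mevalD mevalC.
  have M0 : 0 < m + (1 + K) by lra.
  apply: (strongly_convex_double_exp _ (m + (1 + K)) _ K) => //.
  + by move=> x xX; rewrite /peval mevalD mevalC lerD2r; apply: mf.
  + by move=> v x; rewrite dirderiv_addC; have [] := HK xi xir v x.
  + by move=> v x; rewrite !dirderiv_addC; have [] := HK xi xir v x.
  + have : K / (m + (1 + K)) <= 1 by rewrite ler_pdivrMr //; lra.
    lra.
Qed.
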